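(* Let $B\in\mathbb{C}\setminus\{0\}$ and consider the rational difference equation $$z_{n+1}=\frac{z_{n}z_{n-1}+Bz_{n-1}-Bz_{n}}{z_{n}},\quad n=0,1,\dots,$$ with initial conditions $z_{0},z_{-1}\in\mathbb{C}$. Then its forbidden set $\mathfrak{F}$ (a set of pairs $(z_0,z_{-1})$) equals $$S_{6}=\{(0,0)\}\cup\left\{\left(a,\frac{-B^{2}}{4a+4B}\right)\,\middle|\,a\in\left\{\tfrac{-Bn+B}{2n}\,\middle|\,n\in\mathbb{N}\right\}\right\}$$ $$\cup\bigcup_{\delta\in\mathbb{C}\setminus\left((-\infty,-\frac14]\cup\{0\}\right)}\left\{\left(a,\frac{\delta B^{2}}{a+B}\right)\,\middle|\,a\in P_\delta\setminus\{-B\}\right\}\cup\bigcup_{\delta\in(-\infty,-\frac14)}\left\{\left(a,\frac{\delta B^{2}}{a+B}\right)\,\middle|\,a\in Q_\delta\setminus\{-B\}\right\},$$ where $$P_\delta=\left\{2\delta B\left(\frac{\left(1+\sqrt{1+4\delta}\right)^{n-1}-\left(1-\sqrt{1+4\delta}\right)^{n-1}}{\left(1+\sqrt{1+4\delta}\right)^{n}-\left(1-\sqrt{1+4\delta}\right)^{n}}\right)\,\middle|\,n\in\mathbb{N}\right\},$$ $$Q_\delta=\left\{\frac{-B}{2}\left(1-\sqrt{-4\delta-1}\,\cot\left(n\arccos\left(\tfrac{1}{2\sqrt{-\delta}}\right)\right)\right)\,\middle|\,n\in\mathbb{N}\right\}.$$ Moreover, given $(z_{0},z_{-1})\notin\mathfrak{F}$,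 one has $z_{n+1}=\frac{C-Bz_{n}}{z_{n}}$ for all $n\geq 0$, where $C=z_{-1}(z_{0}+B)$. This implies the following: (a) If $C=0$, then $z_{n}=-B$ for all $n\geq 0$. (b) If $\frac{-C}{B^{2}}\in\mathbb{C}\setminus\left[\frac14,\infty\right)$, then with $\lambda_{1}=\frac{1-\sqrt{1+\frac{4C}{B^{2}}}}{2}$ and $\lambda_{2}=\frac{1+\sqrt{1+\frac{4C}{B^{2}}}}{2}$, $$z_{n}=-B\left(\frac{(B\lambda_{2}+z_{0})\lambda_{1}^{n+1}-(z_{0}+B\lambda_{1})\lambda_{2}^{n+1}}{(B\lambda_{2}+z_{0})\lambda_{1}^{n}-(z_{0}+B\lambda_{1})\lambda_{2}^{n}}\right),\quad n\geq 0.$$ (c) If $\frac{-C}{B^{2}}=\frac14$, then $$z_{n}=-B\left(\frac{-B+(n+1)(2z_{0}+B)}{-2B+4nz_{0}+2nB}\right),\quad n\geq 0.$$ (d) If $\frac{-C}{B^{2}}\in\left(\frac14,\infty\right)$, then with $D=B\sqrt{\frac{-4C}{B^{2}}-1}$ and $\rho=\arccos\left(\sqrt{\frac{B^{2}}{-4C}}\right)$, for all $n\geq 0$, $$z_{n}=-B\sqrt{\frac{-C}{B^{2}}}\left(\frac{D\cos((n+1)\rho)+(-2z_{0}-B)\sin((n+1)\rho)}{D\cos(n\rho)+(-2z_{0}-B)\sin(n\rho)}\right).$$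
   Context: The forbidden set $\mathfrak{F}$ of a second order rational difference equation is the set of initial conditions, written as pairs $(z_{0},z_{-1})\in\mathbb{C}^{2}$ in this order, for which the iteration eventually requires a division by zero (so that $z_n$ is not well defined for some $n\ge 1$; $0/0$ counts as undefined). $\mathbb{N}=\{1,2,3,\dots\}$, and $0^0=1$. $\sqrt{\cdot}$ is the principal complex square root, with branch cut along the negative real numbers; $\arccos$ is the usual real arccosine. In $Q_\delta$, an index $n$ for which the cotangent is undefined contributes no element.
   Formalization: In (a), z_n = -B is claimed for all n ≥ 1, and at n = 0 only when z_{-1} ≠ 0; as printed (a) fails at n = 0 for z_{-1} = 0, e.g. B = 1, z_0 = 1, z_{-1} = 0, where C = 0 but z_0 ≠ -B. *)

(* Defs.v *)
From HB Require Import structures.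
From mathcomp Require Import all_boot all_order all_algebra.
From mathcomp Require Import complex.
From mathcomp Require Import all_classical all_reals all_analysis.
Set Implicit Arguments.
Unset Strict Implicit.
Unset Printing Implicit Defensive.
Import Order.TTheory GRing.Theory Num.Theory.
Local Open Scope classical_set_scope.
Local Open Scope ring_scope.
Local Open Scope complex_scope.

(* complex.sqrtc is the principal square root (nonnegative real part); the
   generic sqrtC of numClosedFieldType is not, since it always has nonnegative
   imaginary part. *)
Notation csqrt := complex.sqrtc.

Section DifferenceEquation.
Variables (R : realType) (B : R[i]).
Implicit Types (p : R[i] * R[i]) (delta : R[i]).

(* (z_n, z_{n-1}) |-> (z_{n+1}, z_n), where None means that z_{n+1} is
   undefined; the library's total division is only used when z_n != 0. *)
Definition step p : option (R[i] * R[i]) :=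
  if p.1 == 0 then None
  else Some ((p.1 * p.2 + B * p.2 - B * p.1) / p.1, p.1).

Definition state p (n : nat) : option (R[i] * R[i]) :=
  iter n (obind step) (Some p).

(* z_n, for the initial conditions p = (z_0, z_{-1}) *)
Definition term p (n : nat) : option R[i] := omap fst (state p n).

Definition forbidden_set : set (R[i] * R[i]) :=
  [set p | exists2 n, (1 <= n)%N & term p n = None].

Definition P_ delta : set R[i] :=
  [set 2 * delta * B *
       (((1 + csqrt (1 + 4 * delta)) ^+ n.-1
         - (1 - csqrt (1 + 4 * delta)) ^+ n.-1)
        / ((1 + csqrt (1 + 4 * delta)) ^+ n
           - (1 - csqrt (1 + 4 * delta)) ^+ n))
  | n in [set n | (1 <= n)%N]].

(* For delta real, delta < -1/4, the number 1 / (2 sqrt (- delta)) is real; Re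
   only converts it to the type R. *)
Definition Q_angle delta : R := acos (complex.Re (1 / (2 * csqrt (- delta)))).

(* indices n at which cot (n * Q_angle delta) is undefined are dropped *)
Definition Q_ delta : set R[i] :=
  [set - B / 2 *
       (1 - csqrt (- 4 * delta - 1)
            * (cos (n%:R * Q_angle delta) / sin (n%:R * Q_angle delta))%:C)
  | n in [set n | (1 <= n)%N /\ sin (n%:R * Q_angle delta) != 0]].

(* an interval of the real line, seen inside the complex numbers *)
Definition real_itv (i : interval R) : set R[i] :=
  [set x%:C | x in [set` i]].

Definition S6 : set (R[i] * R[i]) :=
  [set (0, 0)]
  `|` [set (a, - B ^+ 2 / (4 * a + 4 * B)) | a in
        [set (- B * n%:R + B) / (2 * n%:R) | n in [set n | (1 <= n)%N]]]
  `|` \bigcup_(delta in ~` (real_itv `]-oo, - (1 / 4)] `|` [set 0]))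
        [set (a, delta * B ^+ 2 / (a + B)) | a in P_ delta `\ (- B)]
  `|` \bigcup_(delta in real_itv `]-oo, (- (1 / 4))[)
        [set (a, delta * B ^+ 2 / (a + B)) | a in Q_ delta `\ (- B)].

End DifferenceEquation.

(* Main.v *)
Require Import Defs.
From HB Require Import structures.
From mathcomp Require Import all_boot all_order all_algebra.
From mathcomp Require Import complex.
From mathcomp Require Import all_classical all_reals all_analysis.
From mathcomp Require Import ring lra.
Set Implicit Arguments.
Unset Strict Implicit.
Unset Printing Implicit Defensive.
Import Order.TTheory GRing.Theory Num.Theory.
Local Open Scope classical_set_scope.
Local Open Scope ring_scope.
Local Open Scope complex_scope.

(** Multiplying the equation by z_n shows that z_{n-1} (z_n + B) does not depend
on n.  Calling this constant C, the equation becomes the Riccati equation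
z_{n+1} = (C - B z_n) / z_n, and writing z_n = y_{n+1} / y_n turns it into the
linear recurrence y_{n+2} = - B y_{n+1} + C y_n with y_0 = 1 and y_1 = z_0,
whose solution is [linrec].  As long as the orbit exists, no y_n vanishes; the
orbit breaks down just after the first n >= 1 with y_n = 0.  The forbidden set
therefore consists of the points for which y has a zero of positive index
([forbidden_linrec]), and outside it the orbit is z_n = y_{n+1} / y_n
([term_linrec]).

It remains to solve the recurrence.  Its characteristic roots are - B l, where
l = (1 + s) / 2 or l = (1 - s) / 2 with s ^ 2 = 1 + 4 C / B ^ 2.  Up to constant
factors, y is a combination of their powers when s != 0
([linrec_distinct_roots]), a power times an affine function of n when s = 0
([linrec_double_root]), and, when C / B ^ 2 is real and less than - 1 / 4, a
power times a combination of cosines and sines ([linrec_trig]).  Every such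
formula has the shape w ^ n v_n = K y_n with w and K nonzero.  Hence
y_{n+1} / y_n = w v_{n+1} / v_n, which gives the formulas for z_n, while
y_n = 0 exactly when v_n = 0, an equation of degree one in z_0.  When it has a
solution, this is the n-th element of the set that [S6] attaches to
delta = C / B ^ 2, and z_{-1} is then recovered as C / (z_0 + B).  For C = 0 the
numbers y_n with n >= 1 are multiples of z_0, which leaves only the point
(0, 0). *)

(** * Second order linear recurrences and their closed forms *)

Section LinearRecurrence.
Variables (F : fieldType) (B C : F).
Implicit Types (a w K : F) (u v : nat -> F).

Fixpoint linrec a n : F :=
  if n is m.+1 then
    if m is k.+1 then - B * linrec a m + C * linrec a k else a
  else 1.

Lemma linrecSS a n : linrec a n.+2 = - B * linrec a n.+1 + C * linrec a n.
Proof. by []. Qed.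

Lemma linrec_unique a u :
    (forall n, u n.+2 = - B * u n.+1 + C * u n) -> u 1 = u 0 * a ->
  forall n, u n = u 0 * linrec a n.
Proof.
move=> urec u1 n.
suff [] : u n = u 0 * linrec a n /\ u n.+1 = u 0 * linrec a n.+1 by [].
elim: n => [|n [IH0 IH1]]; first by rewrite /= mulr1.
by split=> //; rewrite urec linrecSS IH0 IH1; ring.
Qed.

(** A closed form of [linrec] is used twice: the ratios of consecutive terms give
the orbit, and the zeros ([linrec_eq0]) give the forbidden set.  The constant K
and the powers of w cancel, and they cancel even when v n vanishes. *)
Lemma linrec_ratio a w K v : w != 0 -> K != 0 ->
    (forall n, w ^+ n * v n = K * linrec a n) ->
  forall n, linrec a n.+1 / linrec a n = w * (v n.+1 / v n).
Proof.
move=> wN0 KN0 vE n; rewrite -[LHS]mul1r -(divff KN0) mulf_div -!vE exprSr.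
by rewrite -[_ * w * _]mulrA -mulf_div divff ?expf_neq0 // mul1r mulrA.
Qed.

Lemma linrec_eq0 a w K v : w != 0 -> K != 0 ->
    (forall n, w ^+ n * v n = K * linrec a n) ->
  forall n, (linrec a n == 0) = (v n == 0).
Proof.
move=> wN0 KN0 vE n; rewrite -(mulrI_eq0 _ (mulfI KN0)) -vE.
by rewrite mulrI_eq0 //; apply: mulfI; rewrite expf_neq0.
Qed.

Hypothesis two_neq0 : 2 != 0 :> F.

Let four_neq0 : 4 != 0 :> F.
Proof.
have -> : 4 = 2 * 2 :> F by ring.
exact: mulf_neq0.
Qed.

(** The numbers l = (1 - s) / 2 and l = (1 + s) / 2 have sum 1 and product
- C / B ^ 2, so the - B l are the roots of t ^ 2 + B t - C. *)
Lemma linrec_distinct_roots a s n : B ^+ 2 * s ^+ 2 = B ^+ 2 + 4 * C ->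
  (- B) ^+ n * ((B * ((1 + s) / 2) + a) * ((1 - s) / 2) ^+ n
                - (a + B * ((1 - s) / 2)) * ((1 + s) / 2) ^+ n)
  = B * s * linrec a n.
Proof.
move=> s2; set l1 := (1 - s) / 2; set l2 := (1 + s) / 2.
have sum_l : l2 = 1 - l1 by rewrite /l1 /l2; field.
have sE : B * s = B * (l2 - l1) by rewrite /l1 /l2; field.
have CE : C = - (B ^+ 2 * (l1 * l2)).
  have -> : C = (B ^+ 2 * s ^+ 2 - B ^+ 2) / 4 by rewrite s2; field.
  by rewrite /l1 /l2; field; rewrite two_neq0.
pose u k := (- B) ^+ k * ((B * l2 + a) * l1 ^+ k - (a + B * l1) * l2 ^+ k).
have u0 : u 0 = B * s by rewrite sE /u; ring.
rewrite -u0; transitivity (u n); first by [].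
apply: linrec_unique; last by rewrite u0 sE /u sum_l; ring.
by move=> k; rewrite /u CE sum_l !exprS; ring.
Qed.

Lemma linrec_double_root a n : 4 * C = - B ^+ 2 ->
  (- B / 2) ^+ n * (B - n%:R * (2 * a + B)) = B * linrec a n.
Proof.
move=> C4.
have CE : C = - (B / 2) ^+ 2.
  have -> : C = 4 * C / 4 by field.
  by rewrite C4; field; rewrite two_neq0.
pose u k := (- B / 2) ^+ k * (B - k%:R * (2 * a + B)).
have u0 : u 0 = B by rewrite /u; ring.
rewrite -[X in _ = X * _]u0; transitivity (u n); first by [].
apply: linrec_unique => [k|]; last by rewrite u0 /u; field.
rewrite /u CE -[k.+2]addn2 -[k.+1]addn1 !natrD !exprD.
by field.
Qed.

End LinearRecurrence.

Arguments linrec {F} B C a !n : simpl nomatch.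

Section Trigonometric.
Variables (R : realType) (B : R[i]).

Lemma cos_natSS (t : R) n :
  cos (n.+2%:R * t) = 2 * cos t * cos (n.+1%:R * t) - cos (n%:R * t).
Proof.
have -> : n.+2%:R * t = n.+1%:R * t + t by rewrite -(natr1 n.+1); ring.
have -> : n%:R * t = n.+1%:R * t - t by rewrite -(natr1 n); ring.
by rewrite cosB cosD; ring.
Qed.

Lemma sin_natSS (t : R) n :
  sin (n.+2%:R * t) = 2 * cos t * sin (n.+1%:R * t) - sin (n%:R * t).
Proof.
have -> : n.+2%:R * t = n.+1%:R * t + t by rewrite -(natr1 n.+1); ring.
have -> : n%:R * t = n.+1%:R * t - t by rewrite -(natr1 n); ring.
by rewrite sinB sinD; ring.
Qed.

(** For C = - B ^ 2 r ^ 2 the characteristic roots are - B r times the complex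
numbers of modulus 1 and argument t or - t; multiplying by e, which is
proportional to sin t, clears the denominator of the coefficient of the sine. *)
Lemma linrec_trig (r e t : R) (C a : R[i]) n :
    2 * r * cos t = 1 -> 2 * r * sin t = e -> C = - B ^+ 2 * (r ^+ 2)%:C ->
  (- B * r%:C) ^+ n * (B * e%:C * (cos (n%:R * t))%:C
                       - (2 * a + B) * (sin (n%:R * t))%:C)
  = B * e%:C * linrec B C a n.
Proof.
move=> cost sint CE.
pose u k := (- B * r%:C) ^+ k * (B * e%:C * (cos (k%:R * t))%:C
                       - (2 * a + B) * (sin (k%:R * t))%:C).
have u0 : u 0 = B * e%:C by rewrite /u !mul0r cos0 sin0 rmorph0 rmorph1; ring.
have two : 2%:C = 2 :> R[i] by rewrite rmorph_nat.
have rc : 2 * r%:C * (cos t)%:C = 1 :> R[i] by rewrite -two -!rmorphM cost.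
have rs : 2 * r%:C * (sin t)%:C = e%:C :> R[i] by rewrite -two -!rmorphM sint.
rewrite -u0; transitivity (u n); first by rewrite u0.
apply: linrec_unique => [k|].
  rewrite /u cos_natSS sin_natSS CE !rmorphB !rmorphM ?rmorphXn /= two !exprS.
  set w := _ ^+ k; set c1 := (cos (k.+1%:R * t))%:C; set s1 := (sin (k.+1%:R * t))%:C.
  set c0 := (cos (k%:R * t))%:C; set s0 := (sin (k%:R * t))%:C.
  set ct := (cos t)%:C in rc *.
  (* Isolates a factor 2 r cos t, to be replaced by 1. *)
  transitivity (w * (B * r%:C) * (B * (2 * r%:C * ct) *
    (B * e%:C * c1 - (2 * a + B) * s1) - B * r%:C *
    (B * e%:C * c0 - (2 * a + B) * s0))); first by ring.
  by rewrite rc; ring.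
rewrite u0 /u !mul1r expr1 -rs.
transitivity (- B * B * r%:C * (sin t)%:C * (2 * r%:C * (cos t)%:C)
  + B * r%:C * (sin t)%:C * (2 * a + B)); first by ring.
by rewrite rc; ring.
Qed.

(** The angle of [linrec_trig] exists as soon as 1 / (2 r) is less than 1; the
characteristic roots are then not real multiples of B. *)
Lemma acos_half_inv (r : R) : 1 / 2 < r ->
  2 * r * cos (acos (1 / (2 * r))) = 1 /\
  2 * r * sin (acos (1 / (2 * r))) = Num.sqrt (4 * r ^+ 2 - 1).
Proof.
move=> r_gt.
have r0 : 0 < 2 * r by lra.
have itv : -1 <= 1 / (2 * r) <= 1.
  rewrite (le_trans _ (divr_ge0 ler01 (ltW r0))) ?lerN10 //=.
  by rewrite ler_pdivrMr // mul1r; lra.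
rewrite acosK ?in_itv //= sin_acos //; split; first by field; rewrite gt_eqF //; lra.
rewrite -[X in X * _ = _](ger0_norm (ltW r0)) -sqrtr_sqr -sqrtrM ?sqr_ge0 //.
by congr Num.sqrt; field; rewrite gt_eqF //; lra.
Qed.

Lemma csqrt_real (x : R) : 0 <= x -> csqrt x%:C = (Num.sqrt x)%:C.
Proof. by move=> x0; rewrite sqrtc_sqrtr // lecR. Qed.

End Trigonometric.

(** * The orbit in terms of the linear recurrence *)

Section Orbits.
Variables (R : realType) (B : R[i]).
Implicit Types (p q : R[i] * R[i]).

Definition invariant p : R[i] := p.2 * (p.1 + B).

(** Division in the field is total, so the formula alone would not exclude that
the denominator vanishes: that it does not is part of the induction. *)
Lemma state_linrec p n q : state B p n = Some q ->
  [/\ linrec B (invariant p) p.1 n != 0,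
      q.1 = linrec B (invariant p) p.1 n.+1 / linrec B (invariant p) p.1 n
    & invariant q = invariant p].
Proof.
elim: n q => [|n IH] q; first by case=> <-; rewrite /= oner_eq0 divr1.
rewrite /state iterS -/(state B p n); case: (state B p n) IH => //= r IH.
have [y0 r1 r2] := IH _ erefl; rewrite /step; case: eqP => //= /eqP r1N0 [<-].
have y1 : linrec B (invariant p) p.1 n.+1 != 0.
  by apply: contraNneq r1N0 => y1; rewrite r1 y1 mul0r.
split=> //=.
  have -> : r.1 * r.2 + B * r.2 - B * r.1 = invariant p - B * r.1.
    by rewrite -r2 /invariant; ring.
  by rewrite r1; rewrite -/(linrec _ _ _ n.+1); field; rewrite y0 y1.
by rewrite -r2 /invariant /=; field.
Qed.

Lemma state_defined p n :
    (forall m, (1 <= m <= n)%N -> linrec B (invariant p) p.1 m != 0) ->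
  exists q, state B p n = Some q.
Proof.
elim: n => [|n IH] y; first by exists p.
have [m /andP[m1 mn]|q qE] := IH; first by apply: y; rewrite m1 leqW.
have [y0 q1 _] := state_linrec qE.
rewrite /state iterS -/(state B p n) qE /= /step ifN; first by eexists.
by rewrite q1 mulf_neq0 ?invr_eq0 // y ?leqnn.
Qed.

Lemma forbidden_linrec p : forbidden_set B p <->
  exists2 n, (1 <= n)%N & linrec B (invariant p) p.1 n = 0.
Proof.
split=> [[n n1 undef]|[n n1 y0]]; last first.
  exists n => //; rewrite /term; case E: (state B p n) => [q|] //=.
  by have [] := state_linrec E; rewrite y0 eqxx.
apply: contrapT => noroot.
have [|q E] := @state_defined p n; last by rewrite /term E in undef.
by move=> m /andP[m1 _]; apply/eqP => ym; apply: noroot; exists m.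
Qed.

Lemma term_linrec p n : ~ forbidden_set B p ->
  term B p n = Some (linrec B (invariant p) p.1 n.+1 / linrec B (invariant p) p.1 n).
Proof.
move=> nf; rewrite /term.
have [m /andP[m1 _]|q qE] := @state_defined p n.
  by apply/eqP => ym; apply: nf; apply/forbidden_linrec; exists m.
by rewrite qE /=; have [_ -> _] := state_linrec qE.
Qed.

End Orbits.

(** * Initial values for which the linear recurrence vanishes *)

Section ZeroSets.
Variables (R : realType) (B : R[i]).
Hypothesis B_neq0 : B != 0.
Implicit Types (a C delta : R[i]).

Let two_neq0 : 2 != 0 :> R[i]. Proof. by rewrite pnatr_eq0. Qed.

Definition linrec_zeros C : set R[i] :=
  [set a | exists2 n, (1 <= n)%N & linrec B C a n = 0].

Lemma linrec_zeros_0 a : linrec_zeros 0 a <-> a = 0.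
Proof.
have yE n : linrec B 0 a n.+1 = (- B) ^+ n * a.
  by elim: n => [|n IH]; [rewrite mul1r | rewrite linrecSS IH exprS; ring].
split=> [[[//|n] _ /eqP]|->]; last by exists 1%N.
by rewrite yE mulf_eq0 expf_eq0 oppr_eq0 (negPf B_neq0) andbF => /eqP.
Qed.

Lemma linrec_zeros_double C : 4 * C = - B ^+ 2 ->
  linrec_zeros C = [set (- B * n%:R + B) / (2 * n%:R) | n in [set n | (1 <= n)%N]].
Proof.
move=> C4.
have zE a n : (1 <= n)%N ->
    (linrec B C a n == 0) = (a == (- B * n%:R + B) / (2 * n%:R)).
  move=> n1; have nN0 : n%:R != 0 :> R[i] by rewrite pnatr_eq0 -lt0n.
  have yE m := linrec_double_root two_neq0 a m C4.
  rewrite (linrec_eq0 _ B_neq0 yE) ?mulf_neq0 ?oppr_eq0 //.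
  rewrite -oppr_eq0 -[RHS]subr_eq0.
  have -> : - (B - n%:R * (2 * a + B)) =
    2 * n%:R * (a - (- B * n%:R + B) / (2 * n%:R)) by field.
  by rewrite !mulf_eq0 pnatr_eq0 (negPf nN0).
apply/seteqP; split=> a /=.
  by move=> [n n1 /eqP]; rewrite zE// => /eqP ->; exists n.
by move=> [n n1 aE]; exists n => //; apply/eqP; rewrite zE// aE.
Qed.

(** The n-th element of [P_ B delta] is the root of an equation of degree one in a.
Its coefficient of a may vanish when s is purely imaginary, but then the
equation has no solution, because s != 0. *)
Lemma linrec_zeros_P delta : delta != 0 -> 1 + 4 * delta != 0 ->
  linrec_zeros (delta * B ^+ 2) = P_ B delta.
Proof.
move=> dN0 d4N0; rewrite /P_; set s := csqrt (1 + 4 * delta).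
have s2 : s ^+ 2 = 1 + 4 * delta by exact: sqr_sqrtc.
have sN0 : s != 0 by rewrite /s sqrtc_eq0.
have BsN0 : B * s != 0 by rewrite mulf_neq0.
have zE a n : (linrec B (delta * B ^+ 2) a n.+1 == 0) =
   (2 * delta * B * ((1 + s) ^+ n - (1 - s) ^+ n) ==
      a * ((1 + s) ^+ n.+1 - (1 - s) ^+ n.+1)).
  have s2B : B ^+ 2 * s ^+ 2 = B ^+ 2 + 4 * (delta * B ^+ 2) by rewrite s2; ring.
  have yE m := linrec_distinct_roots two_neq0 a m s2B.
  rewrite (linrec_eq0 _ BsN0 yE) ?oppr_eq0 // -[RHS]subr_eq0.
  set w := _ - _.
  have -> : w = (2 * delta * B * ((1 + s) ^+ n - (1 - s) ^+ n)
      - a * ((1 + s) ^+ n.+1 - (1 - s) ^+ n.+1)) / 2 ^+ n.+1.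
    have twoN0 : 2 ^+ n != 0 :> R[i] by rewrite expf_neq0.
    have -> : delta = (s ^+ 2 - 1) / 4 by rewrite s2; field.
    by rewrite /w !expr_div_n !(exprS _ n); field.
  by rewrite mulf_eq0 invr_eq0 expf_eq0 pnatr_eq0 andbF orbF.
apply/seteqP; split=> a /=.
  case=> [[//|n] _ /eqP]; rewrite zE => /eqP E; exists n.+1 => //=.
  have den : (1 + s) ^+ n.+1 - (1 - s) ^+ n.+1 != 0.
    apply/eqP => den; move/eqP: E; rewrite den mulr0.
    rewrite !mulf_eq0 (negPf dN0) (negPf B_neq0) pnatr_eq0 /= subr_eq0 => /eqP num.
    (* If the powers of 1 + s and 1 - s agree for the exponents n and n + 1,
       then 2 s (1 + s) ^ n = 0, and both bases are zero, yet their sum is 2. *)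
    have p0 : (1 + s) ^+ n = 0.
      apply: (mulfI (mulf_neq0 (_ : 2 != 0 :> R[i]) sN0)); first by rewrite pnatr_eq0.
      by rewrite mulr0 -[RHS]den !exprS -num; ring.
    move: num; rewrite p0 => /esym/eqP; move/eqP: p0.
    rewrite !expf_eq0 => /andP[_ /eqP p0] /andP[_ /eqP q0].
    have : (2 : R[i]) = 0 by rewrite -[RHS]addr0 -{1}p0 -q0; ring.
    by move/eqP; rewrite pnatr_eq0.
  by rewrite mulrA E mulfK.
case=> [[//|n] _ /= <-].
have [den|den] := eqVneq ((1 + s) ^+ n.+1 - (1 - s) ^+ n.+1) 0.
  (* The quotient by zero has the value 0, which is the zero for n = 1. *)
  by exists 1%N => //=; rewrite den invr0 !mulr0.
by exists n.+1 => //; apply/eqP; rewrite zE mulrA mulfVK.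
Qed.

(** The sine and the cosine of one angle do not vanish together, so the indices
for which the cotangent is undefined give no zero. *)
Lemma linrec_zeros_Q (x : R) : x < - (1 / 4) ->
  linrec_zeros (x%:C * B ^+ 2) = Q_ B x%:C.
Proof.
move=> xlt; pose r := Num.sqrt (- x); pose e := Num.sqrt (- 4 * x - 1).
have r2 : r ^+ 2 = - x by rewrite sqr_sqrtr //; lra.
have r_gt : 1 / 2 < r.
  rewrite -(@ltr_pXn2r _ 2) ?nnegrE ?sqrtr_ge0 // r2; lra.
have e0 : e != 0 by rewrite gt_eqF // sqrtr_gt0; lra.
have two : 2%:C = 2 :> R[i] by rewrite rmorph_nat.
have csr : csqrt (- x%:C) = r%:C by rewrite -rmorphN csqrt_real //; lra.
have cse : csqrt (- 4 * x%:C - 1) = e%:C.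
  have -> : - 4 * x%:C - 1 = (- 4 * x - 1)%:C.
    by rewrite rmorphB rmorphM rmorphN rmorph1 rmorph_nat.
  by rewrite csqrt_real //; lra.
have tE : Q_angle x%:C = acos (1 / (2 * r)).
  by rewrite /Q_angle csr -two -rmorphM -(rmorph1 (real_complex R)) -fmorph_div.
rewrite /Q_ cse tE; set t := acos _.
have [tc ts] := acos_half_inv r_gt.
have {}ts : 2 * r * sin t = e by rewrite ts r2 /e; congr Num.sqrt; ring.
have CE : x%:C * B ^+ 2 = - B ^+ 2 * (r ^+ 2)%:C by rewrite r2 rmorphN; ring.
have yE a n := linrec_trig a n tc ts CE.
have BeN0 : B * e%:C != 0 by rewrite mulf_neq0 // (fmorph_eq0 (real_complex R)).
have zE a n : (linrec B (x%:C * B ^+ 2) a n == 0) =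
   (B * e%:C * (cos (n%:R * t))%:C == (2 * a + B) * (sin (n%:R * t))%:C).
  have BrN0 : - B * r%:C != 0.
    by rewrite mulf_neq0 ?oppr_eq0 // (fmorph_eq0 (real_complex R)) gt_eqF //; lra.
  by rewrite (linrec_eq0 BrN0 BeN0 (yE a)) subr_eq0.
have cotE a n : sin (n%:R * t) != 0 ->
    (linrec B (x%:C * B ^+ 2) a n == 0) =
    (a == - B / 2 * (1 - e%:C * (cos (n%:R * t) / sin (n%:R * t))%:C)).
  move=> sn; rewrite zE fmorph_div.
  have sC : (sin (n%:R * t))%:C != 0 :> R[i] by rewrite (fmorph_eq0 (real_complex R)).
  rewrite eq_sym -subr_eq0 -[RHS]subr_eq0.
  move: sC; set c' := (cos _)%:C; set s' := (sin _)%:C => sC.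
  have -> : (2 * a + B) * s' - B * e%:C * c' =
    2 * s' * (a - - B / 2 * (1 - e%:C * (c' / s'))) by field.
  by rewrite !mulf_eq0 pnatr_eq0 (negPf sC).
apply/seteqP; split=> a /=.
  case=> n n1 yn; have sn : sin (n%:R * t) != 0.
    apply/eqP => sn; move/eqP: yn; rewrite zE sn mulr0 mulf_eq0 (negPf BeN0) /=.
    rewrite (fmorph_eq0 (real_complex R)) => /eqP cn.
    have := cos2Dsin2 (n%:R * t); rewrite cn sn !expr0n addr0 => /eqP.
    by rewrite eq_sym oner_eq0.
  by exists n => //; apply/esym/eqP; rewrite -cotE // yn.
by case=> n [n1 sn] aE; exists n => //; apply/eqP; rewrite cotE // aE.
Qed.

End ZeroSets.

(** * The forbidden set *)

Section ForbiddenSet.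
Variables (R : realType) (B : R[i]).
Hypothesis B_neq0 : B != 0.
Implicit Types (a C delta : R[i]).

Lemma forbidden_zeros a b : forbidden_set B (a, b) <-> linrec_zeros B (b * (a + B)) a.
Proof. exact: forbidden_linrec. Qed.

Lemma zeros_forbidden a C : a + B != 0 -> linrec_zeros B C a ->
  forbidden_set B (a, C / (a + B)).
Proof. by move=> aB Ca; apply/forbidden_zeros; rewrite divfK. Qed.

(** If C != 0, the point (a, b) is determined by a and C through b = C / (a + B),
and the three families of [S6] correspond to 1 + 4 C / B ^ 2 being zero, a
negative real number, or anything else. *)
Lemma forbidden_setE : forbidden_set B = S6 B.
Proof.
apply/seteqP; split=> [[a b]|].
  have [C0|CN0] := eqVneq (b * (a + B)) 0; move/forbidden_zeros.
    rewrite C0 => /(linrec_zeros_0 B_neq0) a0; left; left; left.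
    by move/eqP: C0; rewrite a0 add0r mulf_eq0 (negPf B_neq0) orbF => /eqP ->.
  have [bN0 aBN0] : b != 0 /\ a + B != 0.
    by apply/andP; rewrite -negb_or -mulf_eq0.
  have aNB : a <> - B by move=> aE; rewrite aE addNr eqxx in aBN0.
  pose delta := b * (a + B) / B ^+ 2.
  have CE : b * (a + B) = delta * B ^+ 2 by rewrite divfK // expf_neq0.
  have dN0 : delta != 0 by rewrite mulf_neq0 // invr_neq0 // expf_neq0.
  have bE : delta * B ^+ 2 / (a + B) = b by rewrite -CE mulfK.
  rewrite CE; have [d4|d4] := eqVneq (1 + 4 * delta) 0.
    have C4 : 4 * (delta * B ^+ 2) = - B ^+ 2.
      by rewrite mulrA -[4 * delta](addKr 1) d4; ring.
    rewrite (linrec_zeros_double B_neq0 C4) => a_in; left; left; right.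
    exists a => //; rewrite -C4 -bE; congr pair.
    by field; rewrite aBN0 -mulrDr mulf_neq0.
  have [[x /= xlt xE]|nreal] := pselect (real_itv `]-oo, (- (1 / 4))[ delta).
    rewrite -xE (linrec_zeros_Q B_neq0) // => a_in; right; exists delta.
      by exists x.
    by exists a; rewrite ?bE // -xE; split.
  rewrite (linrec_zeros_P B_neq0 dN0 d4) => a_in; left; right; exists delta.
    move=> [[x /=]|]; last by move/eqP; rewrite (negPf dN0).
    rewrite in_itv /= le_eqVlt => /orP[/eqP xE|xlt] xd; last first.
      by apply: nreal; exists x => //=; rewrite in_itv.
    move/eqP: d4; apply; rewrite -xd xE rmorphN fmorph_div rmorph1 rmorph_nat.
    by field.
  by exists a; rewrite ?bE.
move=> p [[[->|[a a_in <-]]|[delta dnot [a [a_in aNB] <-]]]|[_ [x /= xlt <-] [a [a_in aNB] <-]]].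
- by apply/forbidden_zeros; rewrite mul0r; apply/linrec_zeros_0.
- have C4 : 4 * (- B ^+ 2 / 4) = - B ^+ 2 by field.
  have aB : a + B != 0.
    case: a_in => n n1 <-; have nN0 : n%:R != 0 :> R[i] by rewrite pnatr_eq0 -lt0n.
    have -> : (- B * n%:R + B) / (2 * n%:R) + B = B * n.+1%:R / (2 * n%:R).
      by rewrite -natr1; field.
    by rewrite !(mulf_eq0, invr_eq0) !pnatr_eq0 (negPf B_neq0) /= -lt0n.
  have -> : - B ^+ 2 / (4 * a + 4 * B) = - B ^+ 2 / 4 / (a + B).
    by rewrite -mulrDr invfM mulrA.
  by apply: zeros_forbidden => //; rewrite (linrec_zeros_double B_neq0 C4).
- have dN0 : delta != 0 by apply/eqP => d0; apply: dnot; right.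
  have d4 : 1 + 4 * delta != 0.
    apply/eqP => d4; apply: dnot; left; exists (- (1 / 4)); rewrite /= ?in_itv //=.
    rewrite rmorphN fmorph_div rmorph1 rmorph_nat.
    have -> : delta = (1 + 4 * delta - 1) / 4 by field.
    by rewrite d4; field.
  apply: zeros_forbidden; last by rewrite linrec_zeros_P.
  by rewrite addr_eq0; apply/eqP.
- apply: zeros_forbidden; last by rewrite linrec_zeros_Q.
  by rewrite addr_eq0; apply/eqP.
Qed.

End ForbiddenSet.

(** * Explicit orbits *)

Section ExplicitOrbits.
Variables (R : realType) (B : R[i]).
Hypothesis B_neq0 : B != 0.
Implicit Types (C a : R[i]).

Let two_neq0 : 2 != 0 :> R[i]. Proof. by rewrite pnatr_eq0. Qed.

Lemma orbit_distinct_roots C a : (~` real_itv `[1 / 4, +oo[) (- C / B ^+ 2) ->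
  let l1 := (1 - csqrt (1 + 4 * C / B ^+ 2)) / 2 in
  let l2 := (1 + csqrt (1 + 4 * C / B ^+ 2)) / 2 in
  forall n, linrec B C a n.+1 / linrec B C a n =
    - B * (((B * l2 + a) * l1 ^+ n.+1 - (a + B * l1) * l2 ^+ n.+1)
           / ((B * l2 + a) * l1 ^+ n - (a + B * l1) * l2 ^+ n)).
Proof.
move=> Cnot l1 l2 n; rewrite {}/l1 {}/l2; set s := csqrt _.
have s2 : s ^+ 2 = 1 + 4 * C / B ^+ 2 by exact: sqr_sqrtc.
have sN0 : s != 0.
  rewrite /s sqrtc_eq0; apply/eqP => s0; apply: Cnot; exists (1 / 4).
    by rewrite /= in_itv /= lexx.
  rewrite fmorph_div rmorph1 rmorph_nat.
  have -> : - C / B ^+ 2 = (1 - (1 + 4 * C / B ^+ 2)) / 4 by field.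
  by rewrite s0 subr0.
have s2B : B ^+ 2 * s ^+ 2 = B ^+ 2 + 4 * C by rewrite s2; field.
have yE m := linrec_distinct_roots two_neq0 a m s2B.
by rewrite (linrec_ratio _ _ yE) ?mulf_neq0 ?oppr_eq0.
Qed.

Lemma orbit_double_root C a : - C / B ^+ 2 = 1 / 4 ->
  forall n, linrec B C a n.+1 / linrec B C a n =
    - B * ((- B + n.+1%:R * (2 * a + B))
           / (- 2 * B + 4 * n%:R * a + 2 * n%:R * B)).
Proof.
move=> C4 n.
have {}C4 : 4 * C = - B ^+ 2.
  have -> : C = - (- C / B ^+ 2) * B ^+ 2 by field.
  by rewrite C4; field.
have yE m := linrec_double_root two_neq0 a m C4.
rewrite (linrec_ratio _ B_neq0 yE) ?mulf_neq0 ?oppr_eq0 ?invr_eq0 //.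
set N := B - _; set M := B - _.
have -> : - 2 * B + 4 * n%:R * a + 2 * n%:R * B = - 2 * M by rewrite /M; ring.
have -> : - B + n.+1%:R * (2 * a + B) = - N by rewrite /N; ring.
(* The value a is arbitrary, so M may be zero; only its inverse occurs. *)
by rewrite invfM; move: M^-1 => M1; field.
Qed.

Lemma orbit_trig C a : real_itv `](1 / 4), +oo[ (- C / B ^+ 2) ->
  let D := B * csqrt (- 4 * C / B ^+ 2 - 1) in
  let rho := acos (complex.Re (csqrt (B ^+ 2 / (- 4 * C)))) in
  forall n, linrec B C a n.+1 / linrec B C a n =
    - B * csqrt (- C / B ^+ 2) *
    ((D * (cos (n.+1%:R * rho))%:C + (- 2 * a - B) * (sin (n.+1%:R * rho))%:C)
     / (D * (cos (n%:R * rho))%:C + (- 2 * a - B) * (sin (n%:R * rho))%:C)).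
Proof.
move=> [x xin xE] D rho n.
have xgt : 1 / 4 < x by move: xin; rewrite /= in_itv andbT.
pose r := Num.sqrt x; pose e := Num.sqrt (4 * x - 1).
have r2 : r ^+ 2 = x by rewrite sqr_sqrtr //; lra.
have r_gt : 1 / 2 < r.
  rewrite -(@ltr_pXn2r _ 2) ?nnegrE ?sqrtr_ge0 // r2; lra.
have e0 : e != 0 by rewrite gt_eqF // sqrtr_gt0; lra.
have CE : C = - B ^+ 2 * (r ^+ 2)%:C by rewrite r2 xE; field.
have DE : D = B * e%:C.
  rewrite /D; have -> : - 4 * C / B ^+ 2 - 1 = (4 * x - 1)%:C.
    by rewrite rmorphB rmorphM rmorph1 rmorph_nat /= xE; field.
  by rewrite csqrt_real //; lra.
have rhoE : rho = acos (1 / (2 * r)).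
  rewrite /rho; have -> : B ^+ 2 / (- 4 * C) = ((1 / (2 * r)) ^+ 2)%:C.
    rewrite expr_div_n exprMn CE r2 fmorph_div rmorphXn rmorphM rmorphXn rmorph1 rmorph_nat /=.
    by field; rewrite B_neq0 (fmorph_eq0 (real_complex R)) gt_eqF //; lra.
  rewrite csqrt_real ?sqr_ge0 // sqrtr_sqr ger0_norm //= divr_ge0 //; lra.
have csE : csqrt (- C / B ^+ 2) = r%:C by rewrite -xE csqrt_real //; lra.
have [tc ts] := acos_half_inv r_gt; rewrite csE DE rhoE; move: tc ts.
set t := acos _ => tc ts; rewrite r2 in ts.
have yE m := linrec_trig a m tc ts CE.
have BeN0 : B * e%:C != 0 by rewrite mulf_neq0 // (fmorph_eq0 (real_complex R)).
have BrN0 : - B * r%:C != 0.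
  by rewrite mulf_neq0 ?oppr_eq0 // (fmorph_eq0 (real_complex R)) gt_eqF //; lra.
have N2 : - 2 * a - B = - (2 * a + B) by ring.
by rewrite (linrec_ratio BrN0 BeN0 yE) N2 !mulNr.
Qed.

End ExplicitOrbits.

(* In the C = 0 clause the index n = 0 is claimed only when z_{-1} != 0: if
   z_{-1} = 0 then C = 0 whatever the value of z_0. *)
Theorem theorem7 (R : realType) (B : R[i]) (B_neq0 : B != 0) :
  forbidden_set B = S6 B
  /\ forall z0 zm1 : R[i], ~ forbidden_set B (z0, zm1) ->
     exists z : nat -> R[i],
       (forall n, term B (z0, zm1) n = Some (z n))
       /\ let C := zm1 * (z0 + B) in
          (forall n, z n.+1 = (C - B * z n) / z n)
          /\ (C = 0 ->
              forall n, (1 <= n)%N \/ zm1 != 0 -> z n = - B)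
          /\ ((~` real_itv `[1 / 4, +oo[) (- C / B ^+ 2) ->
              let lambda1 := (1 - csqrt (1 + 4 * C / B ^+ 2)) / 2 in
              let lambda2 := (1 + csqrt (1 + 4 * C / B ^+ 2)) / 2 in
              forall n, z n =
                - B * (((B * lambda2 + z0) * lambda1 ^+ n.+1
                        - (z0 + B * lambda1) * lambda2 ^+ n.+1)
                       / ((B * lambda2 + z0) * lambda1 ^+ n
                          - (z0 + B * lambda1) * lambda2 ^+ n)))
          /\ (- C / B ^+ 2 = 1 / 4 ->
              forall n, z n =
                - B * ((- B + n.+1%:R * (2 * z0 + B))
                       / (- 2 * B + 4 * n%:R * z0 + 2 * n%:R * B)))
          /\ (real_itv `](1 / 4), +oo[ (- C / B ^+ 2) ->
              let D := B * csqrt (- 4 * C / B ^+ 2 - 1) in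
              let rho := acos (complex.Re (csqrt (B ^+ 2 / (- 4 * C)))) in
              forall n, z n =
                - B * csqrt (- C / B ^+ 2) *
                ((D * (cos (n.+1%:R * rho))%:C
                  + (- 2 * z0 - B) * (sin (n.+1%:R * rho))%:C)
                 / (D * (cos (n%:R * rho))%:C
                    + (- 2 * z0 - B) * (sin (n%:R * rho))%:C))).
Proof.
split; first exact: forbidden_setE.
move=> z0 zm1 nf; pose C := zm1 * (z0 + B).
have yN0 n : linrec B C z0 n != 0.
  case: n => [|n]; first exact: oner_neq0.
  by apply/eqP => yn; apply: nf; apply/forbidden_linrec; exists n.+1.
pose z n := linrec B C z0 n.+1 / linrec B C z0 n.
have zrec n : z n.+1 = (C - B * z n) / z n.
  by rewrite /z linrecSS; field; rewrite !yN0.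
exists z; split; first by move=> n; exact: term_linrec.
split; first exact: zrec.
split; last split; last split.
- move=> C0 n; have zN0 k : z k != 0 by rewrite mulf_neq0 ?invr_neq0.
  case: n => [[//|zm1N0]|n _]; last by rewrite zrec /C C0 sub0r mulNr mulfK.
  move/eqP: C0; rewrite mulf_eq0 (negPf zm1N0) addr_eq0 => /eqP z0E.
  by rewrite /z /= divr1.
- exact: orbit_distinct_roots.
- exact: orbit_double_root.
- exact: orbit_trig.
Qed.
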